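(* Let $d_1,d_2,d_3$ be positive integers with $\gcd(d_1,d_2,d_3)=1$ and $3\le d_1<d_2<d_3\le d_1d_2-d_1-d_2$, such that none of them is a linear combination of the other two with non-negative integer coefficients, and let $S_3=\langle d_1,d_2,d_3\rangle$. Then the rescaled genus $h_1=K_1/g_3^2$ of $S_3$ satisfies $$\frac{5}{36}<h_1<\frac{11}{54}.$$
   Context: $S_3=\langle d_1,d_2,d_3\rangle$ is the numerical semigroup of all linear combinations of $d_1,d_2,d_3$ with non-negative integer coefficients. The set of gaps is $\Delta_3=\mathbb{Z}_{>0}\setminus S_3$, and the Frobenius number $F_3$ is the largest element of $\Delta_3$. Put $G_r=\sum_{s\in\Delta_3}s^r$ for $r\ge 0$, $\sigma_k=d_1^k+d_2^k+d_3^k$, $\delta_k=(\sigma_k-1)/2^k$, $g_3=F_3+\sigma_1$, and $$K_1=G_1+\frac{\sigma_1}{2}G_0+\frac{3\delta_1^2+\delta_2}{6}.$$ *)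

(* Defs.v *)
From mathcomp Require Import all_boot all_order all_algebra.
From mathcomp Require Import boolp classical_sets fsbigop.

Set Implicit Arguments.
Unset Strict Implicit.
Unset Printing Implicit Defensive.

Import Order.TTheory GRing.Theory Num.Theory.

Local Open Scope classical_set_scope.
Local Open Scope ring_scope.

Definition lin_comb2 (a b n : nat) : Prop :=
  exists x y : nat, n = (x * a + y * b)%N.

Definition semigroup3 (d1 d2 d3 : nat) : set nat :=
  [set n | exists x y z : nat, n = (x * d1 + y * d2 + z * d3)%N].

Definition gaps (S : set nat) : set nat := [set n | (0 < n)%N /\ ~ S n].

(* The largest gap; the default value 0 is only used if there is none, which
   does not happen for a numerical semigroup (cofinite S) other than nat. *)
Definition frobenius (S : set nat) : nat :=
  xget 0%N (gaps S `&` ubound (gaps S)).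

(* A finitely supported sum: it is the intended one because the gaps of a
   numerical semigroup are finite in number (it would be 0 otherwise). *)
Definition gap_sum (S : set nat) (r : nat) : rat :=
  \sum_(s \in gaps S) (s%:R : rat) ^+ r.

Definition sigma (d1 d2 d3 k : nat) : rat :=
  d1%:R ^+ k + d2%:R ^+ k + d3%:R ^+ k.

Definition delta (d1 d2 d3 k : nat) : rat :=
  (sigma d1 d2 d3 k - 1) / 2 ^+ k.

Definition K1 (d1 d2 d3 : nat) : rat :=
  gap_sum (semigroup3 d1 d2 d3) 1
  + sigma d1 d2 d3 1 / 2 * gap_sum (semigroup3 d1 d2 d3) 0
  + (3 * delta d1 d2 d3 1 ^+ 2 + delta d1 d2 d3 2) / 6.

Definition g3 (d1 d2 d3 : nat) : rat :=
  (frobenius (semigroup3 d1 d2 d3))%:R + sigma d1 d2 d3 1.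

Definition h1 (d1 d2 d3 : nat) : rat := K1 d1 d2 d3 / g3 d1 d2 d3 ^+ 2.

(* Main.v *)
Require Import Defs.
From mathcomp Require Import all_boot all_order all_algebra.
From mathcomp Require Import classical_sets fsbigop.
From mathcomp Require Import zify ring lra.

Set Implicit Arguments.
Unset Strict Implicit.
Unset Printing Implicit Defensive.

Import Order.TTheory GRing.Theory Num.Theory.

(** The proof computes K_1 and g_3 exactly and then compares two polynomials.

    Three positive integers can always be written as the 2 x 2 minors of a
    matrix of relations with a sign pattern: there are natural numbers
    u, v, w, y, m, n with
      (w + u) d1 = y d2 + m d3,  (v + y) d2 = w d1 + n d3,
      (m + n) d3 = u d1 + v d2
    and d1, d2, d3 equal to the corresponding minors
    ([relation_params_exist]).  Zeros are permitted, so that symmetric and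
    nonsymmetric semigroups are treated together.

    These relations show that every i d1 + j d2 can be lowered, by multiples
    of d3, to one whose exponents (i, j) lie in an L-shaped region with d3
    points.  As gcd(d1, d2, d3) = 1, the values on the L-shape represent every
    residue modulo d3, each once by counting: they are the least elements of
    the semigroup in their residue classes ([lshape_apery]).  The gaps are then
    known explicitly, the sums G_0 and G_1 become sums over two rectangles
    ([genus_apery], [gap_total_apery]), and F_3 + d3 is the larger of the
    values at the two outer corners of the L ([frobenius_lshape]).

    Put C = (w + u)(v + y)(m + n), P = m w v, Q = n u y, and
    al = v n (w + u), be = u m (v + y), ga = w y (m + n).  The outcome is
      g_3 = C + max(P, Q),
      12 K_1 = 2 C^2 + 3 C (P + Q) + 2 (P + Q)^2 - P Q - e_2(al, be, ga),
    where e_2 is the second elementary symmetric polynomial, and the new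
    quantities satisfy al + be + ga = C - P - Q and al be ga = P Q C
    ([K1_g3_normal_form]).  The lower bound is e_2 <= (al + be + ga)^2 / 3, with
    equality excluded because al = be = ga and P = Q = 0 would contradict
    al be ga = P Q C.  The upper bound drops e_2 >= 0 and uses
    64 P Q <= C^2, which is the inequality of arithmetic and geometric means in
    each factor of C ([K1_form_bounds]). *)

Local Open Scope nat_scope.

(** * The relation matrix of three integers *)

Lemma ceil_div (a b : nat) : 0 < b -> exists k r, k * b = a + r /\ r < b.
Proof.
move=> b0; have := divn_eq (a + b.-1) b; have := ltn_pmod (a + b.-1) b0.
set k := _ %/ b; set r := _ %% b => lt_r e.
by exists k, (b.-1 - r); split; lia.
Qed.

(** A Euclidean descent on pairs of vectors (i, j) for which i d1 + j d2 is
    divisible by d3.  The pair (l, -y), (w, -h) has determinant -d3, and the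
    first vector has value l d1 - y d2 >= 0.  When the second has value <= 0 its
    opposite gives the second relation; otherwise the pair is replaced by
    (w, -h) and k (w, -h) - (l, -y), with k rounded up so that the new first
    coordinate w' = k w - l lies in [0, w).  Since w < l forces k >= 2, the
    second coordinates keep growing and no sign is lost.  At w = 0 the value
    -h d2 is negative, so the descent stops. *)
Lemma reduced_pair_descent (d1 d2 d3 : nat) : 0 < d2 -> 0 < d3 ->
  forall w l y h m n : nat, w < l -> y <= h ->
  l * h = w * y + d3 -> l * d1 = y * d2 + m * d3 ->
  h * d2 = w * d1 + n * d3 \/ w * d1 = h * d2 + n * d3 ->
  exists u v w y m n : nat,
    [/\ (w + u) * (v + y) = w * y + d3,
        (w + u) * d1 = y * d2 + m * d3 &
        (v + y) * d2 = w * d1 + n * d3].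
Proof.
move=> d2_gt0 d3_gt0; elim/ltn_ind => w IHw l y h m n lt_wl le_yh det valA.
case=> [valB | valB].
  exists (l - w), (h - y), w, y, m, n.
  by rewrite subnKC ?subnK //; exact: ltnW.
have h_gt0 : 0 < h by case: (posnP h) det => // ->; lia.
have w_gt0 : 0 < w.
  by case: (posnP w) valB => // ->; move: (muln_gt0 h d2); lia.
have [k [w' [def_w' lt_w'w]]] := ceil_div l w_gt0.
have k_gt1 : 1 < k by case: k def_w' => [|[|k]] //; lia.
have le_hkh : 2 * h <= k * h by rewrite leq_mul2r k_gt1 orbT.
have [h' def_h'] : exists h', h' + y = k * h.
  by exists (k * h - y); rewrite subnK //; lia.
have det' : w * h' = w' * h + d3.
  have e1 : w * (h' + y) = w * (k * h) by rewrite def_h'.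
  have e2 : k * w * h = (l + w') * h by rewrite def_w'.
  lia.
have valB' : w' * d1 + m * d3 = h' * d2 + k * n * d3.
  have e1 : (h' + y) * d2 = k * h * d2 by rewrite def_h'.
  have e2 : k * w * d1 = (l + w') * d1 by rewrite def_w'.
  have e3 : k * (w * d1) = k * (h * d2 + n * d3) by rewrite valB.
  lia.
have [le_m | /ltnW le_m] := leqP m (k * n).
  apply: (IHw w' lt_w'w w h h' n (k * n - m)) => //; try lia.
  right; rewrite mulnBl; have := leq_mul2r d3 m (k * n); lia.
apply: (IHw w' lt_w'w w h h' n (m - k * n)) => //; try lia.
left; rewrite mulnBl; have := leq_mul2r d3 (k * n) m; lia.
Qed.

(** The three numbers are the minors of the relation matrix with rows
    (w + u, -y, -m), (-w, v + y, -n), (-u, -v, m + n), the sum of which is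
    zero (the form found by Herzog and Johnson). *)
Definition relation_params (d1 d2 d3 u v w y m n : nat) : Prop :=
  [/\ d1 = m * y + m * v + n * y,
      d2 = m * w + n * w + n * u &
      d3 = w * v + u * y + u * v].

(** The descent starts from (l, 0) with l = d3 / gcd(d1, d3) and from a vector
    (w, -gcd(d1, d3)) given by the Bezout identity.  Its final relations
    together with the determinant determine d1 and d2 by Cramer's rule. *)
Lemma relation_params_exist (d1 d2 d3 : nat) :
  0 < d1 -> 0 < d2 -> 0 < d3 ->
  exists u v w y m n, relation_params d1 d2 d3 u v w y m n.
Proof.
move=> d1_gt0 d2_gt0 d3_gt0.
suff [u [v [w [y [m [n [det valA valB]]]]]]] : exists u v w y m n : nat,
    [/\ (w + u) * (v + y) = w * y + d3,
        (w + u) * d1 = y * d2 + m * d3 &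
        (v + y) * d2 = w * d1 + n * d3].
  exists u, v, w, y, m, n; split; last lia.
    apply/eqP; rewrite -(eqn_pmul2l d3_gt0); apply/eqP.
    have e1 : (v + y) * ((w + u) * d1) = (v + y) * (y * d2 + m * d3).
      by rewrite valA.
    have e2 : y * ((v + y) * d2) = y * (w * d1 + n * d3) by rewrite valB.
    have e3 : (w + u) * (v + y) * d1 = (w * y + d3) * d1 by rewrite det.
    lia.
  apply/eqP; rewrite -(eqn_pmul2l d3_gt0); apply/eqP.
  have e1 : (w + u) * ((v + y) * d2) = (w + u) * (w * d1 + n * d3).
    by rewrite valB.
  have e2 : w * ((w + u) * d1) = w * (y * d2 + m * d3) by rewrite valA.
  have e3 : (w + u) * (v + y) * d2 = (w * y + d3) * d2 by rewrite det.
  lia.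
have [a b bezout _] := egcdnP d3 d1_gt0.
have g_gt0 : 0 < gcdn d1 d3 by rewrite gcdn_gt0 d1_gt0.
move: (dvdn_gcdl d1 d3) (dvdn_gcdr d1 d3) bezout g_gt0.
set g := gcdn d1 d3 => /dvdnP[m def_d1] /dvdnP[l def_d3] bezout g_gt0.
have l_gt0 : 0 < l by case: l def_d3 => //; lia.
have w_def := divn_eq (a * d2) l.
have lt_wl : (a * d2) %% l < l by rewrite ltn_mod.
move: w_def lt_wl; set t := _ %/ l; set w := _ %% l => w_def lt_wl.
have valB : w * d1 + t * m * d3 = g * d2 + b * d2 * d3.
  have e1 : a * d2 * d1 = (t * l + w) * d1 by rewrite w_def.
  have e2 : a * d1 * d2 = (b * d3 + g) * d2 by rewrite bezout.
  have e3 : l * d1 = m * d3 by rewrite {1}def_d1 {1}def_d3; lia.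
  have e4 : t * (l * d1) = t * (m * d3) by rewrite e3.
  lia.
have valA : l * d1 = 0 * d2 + m * d3 by rewrite {1}def_d1 {1}def_d3; lia.
have det : l * g = w * 0 + d3 by rewrite muln0 add0n -def_d3.
have [le_t | /ltnW le_t] := leqP (t * m) (b * d2).
  apply: (@reduced_pair_descent d1 d2 d3 d2_gt0 d3_gt0 w l 0 g m
            (b * d2 - t * m)) => //.
  right; rewrite mulnBl; have := leq_mul2r d3 (t * m) (b * d2); lia.
apply: (@reduced_pair_descent d1 d2 d3 d2_gt0 d3_gt0 w l 0 g m
          (t * m - b * d2)) => //.
left; rewrite mulnBl; have := leq_mul2r d3 (b * d2) (t * m); lia.
Qed.

(** * Apery sets and gaps *)

(** The least elements of S in the residue classes modulo d: each class
    contains exactly one member of A, and S is A plus the multiples of d. *)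
Definition apery (S : set nat) (d : nat) (A : seq nat) : Prop :=
  perm_eq [seq a %% d | a <- A] (iota 0 d) /\
  forall n, S n <-> exists2 a, a \in A & exists t, n = a + t * d.

Lemma apery_inj (S : set nat) (d : nat) (A : seq nat) :
  apery S d A -> {in A &, injective (modn^~ d)}.
Proof.
move=> [perm_res _] a b Aa Ab /= eq_ab.
have uniq_res : uniq [seq a %% d | a <- A].
  by rewrite (perm_uniq perm_res) iota_uniq.
have ltA c : c \in A -> index c A < size [seq a %% d | a <- A].
  by rewrite size_map index_mem.
have := nth_uniq 0 (ltA _ Aa) (ltA _ Ab) uniq_res.
rewrite !(nth_map 0) ?index_mem // !nth_index // eq_ab eqxx => /esym/eqP.
by move/(congr1 (nth 0 A)); rewrite !nth_index.
Qed.

(** In each residue class the gaps are the numbers below the Apery element;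
    they are indexed here by their quotient k by d. *)
Lemma gaps_apery (S : set nat) (d : nat) (A : seq nat) (g : nat) :
  0 < d -> S 0 -> apery S d A ->
  gaps S g <-> exists a k, [/\ a \in A, k < a %/ d & g = k * d + a %% d].
Proof.
move=> d_gt0 S0 aperyA; have [perm_res memS] := aperyA; split.
  case=> g_gt0 notSg.
  have : g %% d \in [seq a %% d | a <- A].
    by rewrite (perm_mem perm_res) mem_iota ltn_mod.
  case/mapP => a Aa eq_ga; exists a, (g %/ d); split=> //; last first.
    by rewrite -eq_ga -divn_eq.
  rewrite ltnNge; apply/negP => le_ag; apply: notSg.
  apply/memS; exists a => //; exists (g %/ d - a %/ d).
  rewrite {1}(divn_eq g d) {1}(divn_eq a d) eq_ga mulnBl.
  by have := leq_mul2r d (a %/ d) (g %/ d); lia.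
case=> a [k [Aa lt_k def_g]].
have notSg : ~ S g.
  case/memS => b Ab [t eq_g]; have eq_ab : a = b.
    apply: (apery_inj aperyA) => //=; move/(congr1 (modn^~ d)): eq_g.
    by rewrite /= def_g modnMDl modn_mod addnC modnMDl.
  have := divn_eq a d.
  have : k.+1 * d <= a %/ d * d by rewrite leq_mul2r lt_k orbT.
  by move: eq_g; rewrite def_g -eq_ab; lia.
by split=> //; rewrite lt0n; apply/eqP => g0; apply: notSg; rewrite g0.
Qed.

(** Every gap lies at least d below some Apery element.  The existence of a gap
    makes the largest Apery element exceed d, so that subtracting d from it
    gives a positive number, which is then the largest gap. *)
Lemma frobenius_apery (S : set nat) (d : nat) (A : seq nat) :
  0 < d -> S 0 -> apery S d A -> (exists g, gaps S g) ->
  frobenius S + d \in A /\ forall a, a \in A -> a <= frobenius S + d.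
Proof.
move=> d_gt0 S0 aperyA [g0 gap_g0].
have gapP g := gaps_apery g d_gt0 S0 aperyA.
have [b0 [_ [Ab0 _ _]]] := (gapP g0).1 gap_g0.
have [a Aa max_a] : exists2 a, a \in A & forall b, b \in A -> b <= a.
  case: (A) Ab0 => // x s _; elim: s x => [|y s IHs] x.
    by exists x => [|b]; rewrite ?mem_head // inE => /eqP->.
  have [a s_a max_a] := IHs y.
  exists (maxn x a).
    by case: leqP => _; rewrite ?mem_head // inE s_a orbT.
  by move=> b; rewrite inE => /predU1P[-> | /max_a]; lia.
have ub g : gaps S g -> g + d <= a.
  case/gapP => b [k [Ab lt_k ->]]; have := max_a b Ab; have := divn_eq b d.
  have : k.+1 * d <= b %/ d * d by rewrite leq_mul2r lt_k orbT.
  by lia.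
have le_da : d <= a by have := ub _ gap_g0; lia.
have gap_ad : gaps S (a - d).
  apply/gapP; exists a, (a %/ d).-1; split=> //.
    by rewrite prednK // divn_gt0.
  rewrite {1}(divn_eq a d); have : 0 < a %/ d by rewrite divn_gt0.
  by case: (a %/ d) => // q _; rewrite /=; lia.
have -> : frobenius S = a - d.
  apply: xget_unique => [|z [gap_z /(_ _ gap_ad) le_z]].
    by split=> // g /ub; lia.
  by have := ub _ gap_z; move: le_z => /=; lia.
by rewrite subnK.
Qed.

(** * The L-shaped Apery set *)

(** The values i d1 + j d2 on the L-shaped region obtained from the rectangle
    with sides w + u and v + y by deleting a w by y rectangle at its outer
    corner.  Bottom part and top part are listed separately. *)
Definition lshape (d1 d2 u v w y : nat) : seq nat :=
  [seq i * d1 + j * d2 | i <- iota 0 (w + u), j <- iota 0 v] ++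
  [seq i * d1 + j * d2 | i <- iota 0 u, j <- iota v y].

Lemma mem_lshape (d1 d2 u v w y a : nat) :
  a \in lshape d1 d2 u v w y <->
  exists i j, a = i * d1 + j * d2 /\
    (i < w + u /\ j < v \/ i < u /\ v <= j < v + y).
Proof.
rewrite mem_cat; split.
  case/orP => /allpairsP[[i j] /= []]; rewrite !mem_iota /= => hi hj ->;
    exists i, j; split=> //; lia.
case=> i [j [-> [[hi hj] | [hi hj]]]]; apply/orP; [left | right];
  by apply/allpairsP; exists (i, j); rewrite !mem_iota.
Qed.

(** Outside the L-shape one of the three relations applies: subtract
    (w + u, -y), or (-w, v + y), or (u, v); each lowers the value by a
    nonnegative multiple of d3.  The value itself need not decrease, since m or
    n may vanish; the positive linear form (v + 2y) i + (u + 2w) j strictly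
    decreases in all three cases because d3 = (w + u)(v + y) - w y > 0. *)
Lemma lshape_reduce (d1 d2 d3 u v w y m n : nat) : 0 < d3 ->
  relation_params d1 d2 d3 u v w y m n ->
  forall i j, exists2 a, a \in lshape d1 d2 u v w y &
    exists t, i * d1 + j * d2 = a + t * d3.
Proof.
move=> d3_gt0 [def_d1 def_d2 def_d3] i j.
have valA : (w + u) * d1 = y * d2 + m * d3 by rewrite def_d1 def_d2 def_d3; lia.
have valB : (v + y) * d2 = w * d1 + n * d3 by rewrite def_d1 def_d2 def_d3; lia.
have valC : u * d1 + v * d2 = (m + n) * d3.
  by rewrite def_d1 def_d2 def_d3; lia.
(* Coefficients of the form that decreases under each relation. *)
pose p := v + y + y; pose q := w + u + w.
have [N] := ubnP (p * i + q * j); elim: N i j => // N IHN i j ltN.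
have step i' j' s : p * i' + q * j' < p * i + q * j ->
    i * d1 + j * d2 = i' * d1 + j' * d2 + s * d3 ->
    exists2 a, a \in lshape d1 d2 u v w y &
      exists t, i * d1 + j * d2 = a + t * d3.
  move=> lt_ij ->; have [|a Aa [t ->]] := IHN i' j'; first lia.
  by exists a => //; exists (t + s); lia.
have [le_i | lt_i] := leqP (w + u) i.
  have [x def_i] : exists x, i = x + (w + u) by exists (i - (w + u)); lia.
  by apply: (step x (j + y) m); rewrite /p /q def_i; lia.
have [le_j | lt_j] := leqP (v + y) j.
  have [x def_j] : exists x, j = x + (v + y) by exists (j - (v + y)); lia.
  by apply: (step (i + w) x n); rewrite /p /q def_j; lia.
have [le_iu | lt_iu] := leqP u i; last first.
  exists (i * d1 + j * d2); last by exists 0; lia.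
  by apply/mem_lshape; exists i, j; split=> //; lia.
have [le_jv | lt_jv] := leqP v j; last first.
  exists (i * d1 + j * d2); last by exists 0; lia.
  by apply/mem_lshape; exists i, j; split=> //; lia.
have [x def_i] : exists x, i = x + u by exists (i - u); lia.
have [z def_j] : exists z, j = z + v by exists (j - v); lia.
have drop_gt0 : 0 < p * u + q * v.
  move: d3_gt0; rewrite /p /q def_d3.
  by case: (u) => [|u']; case: (v) => [|v']; lia.
apply: (step x z (m + n)); last by rewrite def_i def_j; lia.
by rewrite def_i def_j !mulnDr addnACA -[X in X < _]addn0 ltn_add2l.
Qed.

(** Two Bezout identities; the factor d3 - 1 stands for -1 modulo d3. *)
Lemma residue_attained (d1 d2 d3 r : nat) :
  0 < d1 -> 0 < d3 -> gcdn (gcdn d1 d2) d3 = 1 ->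
  exists i j, i * d1 + j * d2 = r %[mod d3].
Proof.
move=> d1_gt0 d3_gt0 gcd1.
have g_gt0 : 0 < gcdn d1 d2 by rewrite gcdn_gt0 d1_gt0.
have [a b bez1 _] := egcdnP d2 d1_gt0.
have [k l bez2 _] := egcdnP d3 g_gt0; rewrite gcd1 in bez2.
exists (r * k * a), (r * k * b * d3.-1).
suff -> : r * k * a * d1 + r * k * b * d3.-1 * d2 =
          (r * k * b * d2 + r * l) * d3 + r by rewrite modnMDl.
have e1 : r * k * (a * d1) = r * k * (b * d2 + gcdn d1 d2) by rewrite bez1.
have e2 : r * (k * gcdn d1 d2) = r * (l * d3 + 1) by rewrite bez2.
by case: (d3) d3_gt0 e2 => // d _ e2; rewrite /=; lia.
Qed.

(** The reductions show that the L-shape meets every residue class modulo d3; it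
    has (w + u) v + u y = d3 points, hence meets each of them once. *)
Lemma lshape_apery (d1 d2 d3 u v w y m n : nat) :
  0 < d1 -> 0 < d3 -> gcdn (gcdn d1 d2) d3 = 1 ->
  relation_params d1 d2 d3 u v w y m n ->
  apery (semigroup3 d1 d2 d3) d3 (lshape d1 d2 u v w y).
Proof.
move=> d1_gt0 d3_gt0 gcd1 rel; have [_ _ def_d3] := rel.
set A := lshape _ _ _ _ _ _.
have sub : {subset iota 0 d3 <= [seq a %% d3 | a <- A]}.
  move=> r; rewrite mem_iota /= add0n => lt_r.
  have [i [j eq_r]] := residue_attained r d1_gt0 d3_gt0 gcd1.
  have [a Aa [t def_a]] := lshape_reduce d3_gt0 rel i j.
  apply/mapP; exists a => //.
  by rewrite -(modn_small lt_r) -eq_r def_a addnC modnMDl.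
have size_le : size [seq a %% d3 | a <- A] <= size (iota 0 d3).
  by rewrite size_map size_cat !size_allpairs !size_iota def_d3; lia.
split.
  apply: uniq_perm; [|exact: iota_uniq|].
    exact: leq_size_uniq (iota_uniq 0 d3) sub size_le.
  by move=> r; have [_ ->] := uniq_min_size (iota_uniq 0 d3) sub size_le.
move=> s; split.
  case=> i [j [k ->]]; have [a Aa [t ->]] := lshape_reduce d3_gt0 rel i j.
  by exists a => //; exists (t + k); lia.
case=> a /mem_lshape[i [j [-> _]]] [t ->].
by exists i, j, t.
Qed.

(** The value i d1 + j d2 is largest at one of the two outer corners
    (w + u - 1, v - 1) and (u - 1, v + y - 1), where adding d1 + d2 gives C + P
    and C + Q.  If v = 0 the first corner is missing, but then P = 0 and the
    second corner dominates; likewise for u = 0. *)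
Lemma frobenius_lshape (d1 d2 d3 u v w y m n : nat) :
  0 < d1 -> 0 < d3 -> gcdn (gcdn d1 d2) d3 = 1 ->
  relation_params d1 d2 d3 u v w y m n ->
  (exists g, gaps (semigroup3 d1 d2 d3) g) ->
  frobenius (semigroup3 d1 d2 d3) + (d1 + d2 + d3) =
  (w + u) * (v + y) * (m + n) + maxn (m * w * v) (n * u * y).
Proof.
move=> d1_gt0 d3_gt0 gcd1 rel gap_ex.
have S0 : semigroup3 d1 d2 d3 0 by exists 0, 0, 0.
have aperyS := lshape_apery d1_gt0 d3_gt0 gcd1 rel.
have [] := frobenius_apery d3_gt0 S0 aperyS gap_ex.
set F := frobenius _; set C := _ * (m + n); set P := m * w * v.
set Q := n * u * y => /mem_lshape[i [j [def_F in_ij]]] F_max.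
have [def_d1 def_d2 def_d3] := rel.
have cornerP : (w + u) * d1 + v * d2 = C + P.
  by rewrite /C /P def_d1 def_d2; lia.
have cornerQ : u * d1 + (v + y) * d2 = C + Q.
  by rewrite /C /Q def_d1 def_d2; lia.
have corner i' j' : i < i' -> j < j' -> F + (d1 + d2 + d3) <= i' * d1 + j' * d2.
  move=> lt_i lt_j; have : i.+1 * d1 <= i' * d1 by rewrite leq_mul2r lt_i orbT.
  have : j.+1 * d2 <= j' * d2 by rewrite leq_mul2r lt_j orbT.
  by lia.
have attained i' j' : i' < w + u /\ j' < v \/ i' < u /\ j' < v + y ->
    i'.+1 * d1 + j'.+1 * d2 <= F + (d1 + d2 + d3).
  move=> in_ij'; suff : i' * d1 + j' * d2 <= F + d3 by lia.
  by apply: F_max; apply/mem_lshape; exists i', j'; split=> //; lia.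
have wu_gt0 : 0 < w + u.
  by move: d3_gt0; rewrite def_d3; case: (w) (u) => [|?] [].
have vy_gt0 : 0 < v + y.
  move: d3_gt0; rewrite def_d3.
  by case: (v) (y) => [|?] [|?] //; rewrite !muln0.
have reachP : 0 < v -> C + P <= F + (d1 + d2 + d3).
  move=> v_gt0; rewrite -cornerP -(prednK v_gt0) -(prednK wu_gt0).
  by apply: attained; lia.
have reachQ : 0 < u -> C + Q <= F + (d1 + d2 + d3).
  move=> u_gt0; rewrite -cornerQ -(prednK u_gt0) -(prednK vy_gt0).
  by apply: attained; lia.
apply/eqP; rewrite eqn_leq addn_maxr geq_max leq_max; apply/and3P; split.
- rewrite -cornerP -cornerQ; apply/orP.
  by case: in_ij => -[lt_i lt_j]; [left | right]; apply: corner => //; lia.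
- have [v0 | /reachP //] := posnP v.
  move: reachQ; rewrite /P v0 muln0 addn0 => reachQ.
  apply: leq_trans (leq_addr Q C) (reachQ _).
  by move: d3_gt0; rewrite def_d3 v0; case: (u); rewrite // !muln0.
have [u0 | /reachQ //] := posnP u.
  move: reachP; rewrite /Q u0 muln0 mul0n addn0 => reachP.
  apply: leq_trans (leq_addr P C) (reachP _).
  by move: d3_gt0; rewrite def_d3 u0; case: (v); rewrite // !muln0.
Qed.

Local Open Scope ring_scope.

(** * The sums over the gaps *)

Lemma gap_sum_apery (S : set nat) (d : nat) (A : seq nat) (r : nat) :
  (0 < d)%N -> S 0%N -> apery S d A ->
  gap_sum S r =
  \sum_(a <- A) \sum_(k <- iota 0 (a %/ d)) (k * d + a %% d)%:R ^+ r.
Proof.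
move=> d_gt0 S0 aperyA; have [perm_res memS] := aperyA.
set s := [seq (k * d + a %% d)%N | a <- A, k <- iota 0 (a %/ d)].
have uniq_s : uniq s.
  apply: allpairs_uniq_dep; last first.
  - move=> _ _ /allpairsPdep[a [k [Aa _ ->]]] /allpairsPdep[b [l [Ab _ ->]]] /=.
    move=> eq_kl; have eq_ab : a = b.
      apply: (apery_inj aperyA) => //=; move/(congr1 (modn^~ d)): eq_kl.
      by rewrite /= !modnMDl !modn_mod.
    move: eq_kl; rewrite -eq_ab => /addIn/eqP.
    by rewrite eqn_pmul2r // => /eqP->.
  - by move=> a _; exact: iota_uniq.
  by apply: (@map_uniq _ _ (modn^~ d)); rewrite (perm_uniq perm_res) iota_uniq.
suff -> : gap_sum S r = \sum_(g <- s) g%:R ^+ r by rewrite /s big_allpairs_dep.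
rewrite (fsbig_seq _ _ uniq_s) /gap_sum; congr (\sum_(i \in _) _).
apply/seteqP; split => g /=.
  case/(gaps_apery g d_gt0 S0 aperyA) => a [k [Aa lt_k def_g]].
  by apply/allpairsPdep; exists a, k; split=> //; rewrite mem_iota.
case/allpairsPdep => a [k [Aa]]; rewrite mem_iota => /= lt_k def_g.
by apply/(gaps_apery g d_gt0 S0 aperyA); exists a, k; split.
Qed.

Lemma sum_iota_id (n : nat) :
  \sum_(k <- iota 0 n) k%:R = n%:R * (n%:R - 1) / 2 :> rat.
Proof.
elim: n => [|n IHn]; first by rewrite big_nil !mul0r.
by rewrite -addn1 iotaD big_cat big_seq1 /= IHn add0n natrD; field.
Qed.

Lemma sum_iota_sqr (n : nat) :
  \sum_(k <- iota 0 n) k%:R ^+ 2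
  = n%:R * (n%:R - 1) * (2 * n%:R - 1) / 6 :> rat.
Proof.
elim: n => [|n IHn]; first by rewrite big_nil !mul0r.
by rewrite -addn1 iotaD big_cat big_seq1 /= IHn add0n natrD; field.
Qed.

Lemma sum_iota_affine (c b : rat) (n : nat) :
  \sum_(k <- iota 0 n) (c + k%:R * b) = n%:R * c + n%:R * (n%:R - 1) / 2 * b.
Proof.
rewrite big_split /= -mulr_suml sum_iota_id big_const_seq count_predT size_iota.
by rewrite iter_addr_0 -[c *+ n]mulr_natl.
Qed.

Lemma sum_iota_affine_sqr (c b : rat) (n : nat) :
  \sum_(k <- iota 0 n) (c + k%:R * b) ^+ 2
  = n%:R * c ^+ 2 + n%:R * (n%:R - 1) * c * b
    + n%:R * (n%:R - 1) * (2 * n%:R - 1) / 6 * b ^+ 2.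
Proof.
transitivity (\sum_(k <- iota 0 n) (c ^+ 2 + k%:R * (2 * c * b))
              + \sum_(k <- iota 0 n) k%:R ^+ 2 * b ^+ 2).
  by rewrite -big_split; apply: eq_bigr => k _ /=; ring.
by rewrite sum_iota_affine -mulr_suml sum_iota_sqr; field.
Qed.

(** Write a = q d + r.  The class of a contributes q = (a - r) / d gaps, and the
    remainders r run over 0, ..., d - 1. *)
Lemma genus_apery (S : set nat) (d : nat) (A : seq nat) :
  (0 < d)%N -> S 0%N -> apery S d A ->
  gap_sum S 0 = (\sum_(a <- A) a%:R - d%:R * (d%:R - 1) / 2) / d%:R.
Proof.
move=> d_gt0 S0 aperyA; have dN0 : d%:R != 0 :> rat by rewrite pnatr_eq0 -lt0n.
apply: (canRL (mulfK dN0)); rewrite (gap_sum_apery 0 d_gt0 S0 aperyA).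
rewrite -sum_iota_id -(perm_big _ aperyA.1) /= big_map mulr_suml -sumrB.
apply: eq_bigr => a _; under eq_bigr do rewrite expr0.
rewrite big_const_seq count_predT size_iota iter_addr_0.
by rewrite {2}(divn_eq a d) natrD natrM addrK.
Qed.

(** With a = q d + r, the class of a contributes the arithmetic progression
    r, r + d, ..., a - d, and 2 d times its sum is (a^2 - d a) - (r^2 - d r). *)
Lemma gap_total_apery (S : set nat) (d : nat) (A : seq nat) :
  (0 < d)%N -> S 0%N -> apery S d A ->
  gap_sum S 1 =
  (\sum_(a <- A) a%:R ^+ 2 - d%:R * \sum_(a <- A) a%:R
   - d%:R * (d%:R - 1) * (2 * d%:R - 1) / 6
   + d%:R * (d%:R * (d%:R - 1) / 2)) / (2 * d%:R).
Proof.
move=> d_gt0 S0 aperyA; have dN0 : d%:R != 0 :> rat by rewrite pnatr_eq0 -lt0n.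
have d2N0 : 2 * d%:R != 0 :> rat by rewrite mulf_neq0.
apply: (canRL (mulfK d2N0)); rewrite (gap_sum_apery 1 d_gt0 S0 aperyA).
rewrite -sum_iota_id -sum_iota_sqr -!(perm_big _ aperyA.1) /= !big_map.
rewrite mulr_suml !mulr_sumr -!sumrB -big_split /=; apply: eq_bigr => a _.
transitivity ((\sum_(k <- iota 0 (a %/ d)) ((a %% d)%:R + k%:R * d%:R))
              * (2 * d%:R) : rat).
  congr (_ * _); apply: eq_bigr => k _.
  by rewrite expr1 natrD natrM addrC.
rewrite sum_iota_affine.
have -> : a%:R = (a %/ d)%:R * d%:R + (a %% d)%:R :> rat.
  by rewrite -natrM -natrD -divn_eq.
by field.
Qed.

(** The top part of the L-shape is a difference of two rectangles of
    width u. *)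
Lemma sum_lshape (F : nat -> rat) (d1 d2 u v w y : nat)
    (R := fun a b => \sum_(i <- iota 0 a) \sum_(j <- iota 0 b)
                       F (i * d1 + j * d2)%N) :
  \sum_(a <- lshape d1 d2 u v w y) F a
  = R (w + u)%N v + R u (v + y)%N - R u v.
Proof.
rewrite /lshape big_cat !big_allpairs_dep -addrA; congr (_ + _) => /=.
rewrite -sumrB; apply: eq_bigr => i _.
by rewrite iotaD big_cat /= add0n addrAC subrr add0r.
Qed.

Lemma sum_rectangle (d1 d2 a b : nat) :
  \sum_(i <- iota 0 a) \sum_(j <- iota 0 b) (i * d1 + j * d2)%:R
  = d1%:R * (a%:R * (a%:R - 1) / 2) * b%:R
    + d2%:R * a%:R * (b%:R * (b%:R - 1) / 2) :> rat.
Proof.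
transitivity (\sum_(i <- iota 0 a)
  (b%:R * (b%:R - 1) / 2 * d2%:R + i%:R * (d1%:R * b%:R)) : rat).
  apply: eq_bigr => i _; under eq_bigr do rewrite natrD !natrM.
  by rewrite sum_iota_affine; ring.
by rewrite sum_iota_affine; ring.
Qed.

Lemma sum_rectangle_sqr (d1 d2 a b : nat) :
  \sum_(i <- iota 0 a) \sum_(j <- iota 0 b) (i * d1 + j * d2)%:R ^+ 2
  = d1%:R ^+ 2 * (a%:R * (a%:R - 1) * (2 * a%:R - 1) / 6) * b%:R
    + 2 * d1%:R * d2%:R * (a%:R * (a%:R - 1) / 2) * (b%:R * (b%:R - 1) / 2)
    + d2%:R ^+ 2 * a%:R * (b%:R * (b%:R - 1) * (2 * b%:R - 1) / 6) :> rat.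
Proof.
transitivity (\sum_(i <- iota 0 a)
    (b%:R * (b%:R - 1) * (2 * b%:R - 1) / 6 * d2%:R ^+ 2
     + i%:R * (b%:R * (b%:R - 1) * d1%:R * d2%:R))
  + \sum_(i <- iota 0 a) i%:R ^+ 2 * (d1%:R ^+ 2 * b%:R) : rat).
  rewrite -big_split; apply: eq_bigr => i _ /=.
  under eq_bigr do rewrite natrD !natrM.
  by rewrite sum_iota_affine_sqr; ring.
by rewrite sum_iota_affine -mulr_suml sum_iota_sqr; field.
Qed.

(** * The rescaled genus in terms of the relations *)

(** Twelve times K_1, by [K1_params] below. *)
Definition K1_form (R : realFieldType) (C P Q al be ga : R) : R :=
  2 * C ^+ 2 + 3 * C * (P + Q) + 2 * (P + Q) ^+ 2 - P * Q
  - (al * be + al * ga + be * ga).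

(** After the sums over the L-shape have been evaluated, this is an identity of
    rational functions in u, v, w, y, m, n whose only denominator is d3. *)
Lemma K1_params (d1 d2 d3 u v w y m n : nat)
    (C := (w + u)%:R * (v + y)%:R * (m + n)%:R : rat)
    (P := m%:R * w%:R * v%:R : rat) (Q := n%:R * u%:R * y%:R : rat)
    (al := v%:R * n%:R * (w + u)%:R : rat)
    (be := u%:R * m%:R * (v + y)%:R : rat)
    (ga := w%:R * y%:R * (m + n)%:R : rat) :
  (0 < d1)%N -> (0 < d3)%N -> gcdn (gcdn d1 d2) d3 = 1%N ->
  relation_params d1 d2 d3 u v w y m n ->
  12 * K1 d1 d2 d3 = K1_form C P Q al be ga.
Proof.
move=> d1_gt0 d3_gt0 gcd1 rel.
have S0 : semigroup3 d1 d2 d3 0%N by exists 0%N, 0%N, 0%N.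
have aperyS := lshape_apery d1_gt0 d3_gt0 gcd1 rel.
rewrite /K1 /delta /sigma !expr1 (genus_apery d3_gt0 S0 aperyS).
rewrite (gap_total_apery d3_gt0 S0 aperyS) !sum_lshape.
rewrite !sum_rectangle !sum_rectangle_sqr /K1_form /C /P /Q /al /be /ga.
have d3N0 : d3%:R != 0 :> rat by rewrite pnatr_eq0 -lt0n.
case: rel d3N0 => -> -> -> {d1_gt0 d3_gt0 gcd1 S0 aperyS}.
by rewrite !natrD !natrM => d3N0; field.
Qed.

(** Since C = al + be + ga + P + Q, three times the form minus 5 (C + P)^2 is
    C P + 11 C Q + 5 Q^2 + 7 P Q plus half the sum of the squared differences of
    al, be, ga.  It vanishes only if P = Q = 0 and al = be = ga; then
    al be ga = 0 while al + be + ga = C > 0.  The form is symmetric in P and Q,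
    which covers the other case. *)
Lemma K1_form_lower (R : realFieldType) (C P Q al be ga G : R) :
  0 < C -> 0 <= P -> 0 <= Q -> 0 <= al -> 0 <= be -> 0 <= ga ->
  al + be + ga = C - P - Q -> al * be * ga = P * Q * C ->
  G = C + P \/ G = C + Q ->
  5 * G ^+ 2 < 3 * K1_form C P Q al be ga.
Proof.
wlog -> : P Q G / G = C + P.
  move=> wlogP C0 P0 Q0 al0 be0 ga0 e1 e2 [eG|eG].
    by apply: wlogP => //; left.
  have -> : K1_form C P Q al be ga = K1_form C Q P al be ga.
    by rewrite /K1_form; ring.
  apply: wlogP => //; last by left.
  - by rewrite e1; ring.
  - by rewrite e2; ring.
move=> C0 P0 Q0 al0 be0 ga0 sum prod _.
rewrite -subr_gt0 /K1_form.
have -> : 3 * (2 * C ^+ 2 + 3 * C * (P + Q) + 2 * (P + Q) ^+ 2 - P * Q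
  - (al * be + al * ga + be * ga)) - 5 * (C + P) ^+ 2 =
  C * P + 11 * (C * Q) + 5 * Q ^+ 2 + 7 * (P * Q) +
  ((al - be) ^+ 2 + (al - ga) ^+ 2 + (be - ga) ^+ 2) / 2.
  have -> : C = al + be + ga + P + Q by rewrite sum; ring.
  by field.
have sq0 : 0 <= ((al - be) ^+ 2 + (al - ga) ^+ 2 + (be - ga) ^+ 2) / 2.
  by rewrite divr_ge0 // !addr_ge0 // sqr_ge0.
have CP0 : 0 <= C * P by rewrite mulr_ge0 // ltW.
have CQ0 : 0 <= C * Q by rewrite mulr_ge0 // ltW.
have PQ0 : 0 <= P * Q by rewrite mulr_ge0.
have Q20 := sqr_ge0 Q.
have sum_gt0 (a b c d e : R) : 0 <= a -> 0 <= b -> 0 <= c -> 0 <= d ->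
    0 <= e -> 0 < a \/ 0 < b -> 0 < a + 11 * b + 5 * c + 7 * d + e.
  by move=> a0 b0 c0 d0 e0 [a_gt0 | b_gt0]; lra.
have [P_gt0 | P_le0] := ltrP 0 P.
  by apply: sum_gt0 => //; left; rewrite mulr_gt0.
have [Q_gt0 | Q_le0] := ltrP 0 Q.
  by apply: sum_gt0 => //; right; rewrite mulr_gt0.
have P_eq0 : P = 0 by lra.
have Q_eq0 : Q = 0 by lra.
subst P Q.
have C2 : 0 < C ^+ 2 by rewrite exprn_gt0.
have pair_gt0 (b c : R) : b + c = C -> 0 < b ^+ 2 + c ^+ 2.
  move=> bc; have sq := sqr_ge0 (b - c).
  suff : C ^+ 2 = 2 * (b ^+ 2 + c ^+ 2) - (b - c) ^+ 2 by lra.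
  by rewrite -bc; ring.
have := sqr_ge0 (al - be); have := sqr_ge0 (al - ga); have := sqr_ge0 (be - ga).
have : al * be * ga == 0 by rewrite prod !mul0r.
rewrite !mulf_eq0 -orbA => /or3P[] /eqP e; rewrite e in sum *.
- by have := pair_gt0 be ga ltac:(lra); rewrite !sub0r !sqrrN; lra.
- by have := pair_gt0 al ga ltac:(lra); rewrite !sub0r !subr0 !sqrrN; lra.
by have := pair_gt0 al be ltac:(lra); rewrite !subr0; lra.
Qed.

(** From Q <= P and 64 P Q <= C^2 follows 8 Q <= C.  Expanding the difference
    around P = Q and C = 8 Q leaves nonnegative terms and a positive multiple of
    C^2. *)
Lemma K1_form_upper (R : realFieldType) (C P Q al be ga : R) :
  0 < C -> 0 <= Q -> Q <= P -> 0 <= al -> 0 <= be -> 0 <= ga ->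
  64 * (P * Q) <= C ^+ 2 ->
  9 * K1_form C P Q al be ga < 22 * (C + P) ^+ 2.
Proof.
move=> C0 Q0 le_QP al0 be0 ga0 amgm.
have C_ge0 := ltW C0; have PQ_ge0 : 0 <= P - Q by rewrite subr_ge0.
have Q_small : 8 * Q <= C.
  have QQ : Q ^+ 2 <= P * Q by rewrite expr2 ler_wpM2r.
  rewrite leNgt; apply/negP => lt_C.
  have := mulr_gt0 C0 C0; have : C * C < 8 * Q * (8 * Q) by exact: ltr_pM.
  lra.
have ab0 := mulr_ge0 al0 be0; have ac0 := mulr_ge0 al0 ga0.
have bc0 := mulr_ge0 be0 ga0.
rewrite -subr_gt0 /K1_form.
have -> : 22 * (C + P) ^+ 2
  - 9 * (2 * C ^+ 2 + 3 * C * (P + Q) + 2 * (P + Q) ^+ 2 - P * Q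
         - (al * be + al * ga + be * ga)) =
  4 * C ^+ 2 + 17 * (C * P) - 27 * (C * Q) + 4 * P ^+ 2 - 27 * (P * Q)
  - 18 * Q ^+ 2 + 9 * (al * be + al * ga + be * ga) by ring.
have C8Q_ge0 : 0 <= C - 8 * Q by rewrite subr_ge0.
have s1 := mulr_ge0 PQ_ge0 C8Q_ge0.
have s2 := mulr_ge0 C8Q_ge0 C_ge0.
have s3 := mulr_ge0 C8Q_ge0 Q0.
have s4 := mulr_ge0 PQ_ge0 Q0.
have s5 := sqr_ge0 (P - Q).
have C2 : 0 < C ^+ 2 by rewrite exprn_gt0.
lra.
Qed.

Lemma K1_form_bounds (R : realFieldType) (C P Q al be ga K G : R) :
  0 < C -> 0 <= P -> 0 <= Q -> 0 <= al -> 0 <= be -> 0 <= ga ->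
  al + be + ga = C - P - Q -> al * be * ga = P * Q * C ->
  64 * (P * Q) <= C ^+ 2 ->
  12 * K = K1_form C P Q al be ga -> G = C + Num.max P Q ->
  5 / 36 < K / G ^+ 2 /\ K / G ^+ 2 < 11 / 54.
Proof.
move=> C0 P0 Q0 al0 be0 ga0 sum prod amgm K_eq G_eq.
have G_gt0 : 0 < G by rewrite G_eq ltr_pwDl // le_max P0.
have G2_gt0 : 0 < G ^+ 2 by rewrite exprn_gt0.
rewrite ltr_pdivlMr // ltr_pdivrMr //; split.
  have eG : G = C + P \/ G = C + Q by rewrite G_eq; case: leP; [right | left].
  have lower := K1_form_lower C0 P0 Q0 al0 be0 ga0 sum prod eG.
  by rewrite -K_eq in lower; lra.
have upper : 9 * (12 * K) < 22 * G ^+ 2; last by lra.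
rewrite K_eq G_eq; have [le_PQ | /ltW le_QP] := leP P Q.
  have -> : K1_form C P Q al be ga = K1_form C Q P al be ga.
    by rewrite /K1_form; ring.
  by apply: K1_form_upper; rewrite // [Q * P]mulrC.
exact: K1_form_upper.
Qed.

(** The product of w u <= ((w + u) / 2)^2 and its two analogues. *)
Lemma C_product (u v w y m n : nat) :
  64 * ((m%:R * w%:R * v%:R) * (n%:R * u%:R * y%:R)) <=
  ((w + u)%:R * (v + y)%:R * (m + n)%:R) ^+ 2 :> rat.
Proof.
have amgm (a b : nat) : 4 * (a%:R * b%:R) <= (a + b)%:R ^+ 2 :> rat.
  by rewrite natrD -subr_ge0; have sq0 := sqr_ge0 (a%:R - b%:R : rat); lra.
have nn (a b : nat) : 0 <= 4 * (a%:R * b%:R) :> rat by rewrite !mulr_ge0.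
rewrite !exprMn; set R := (X in _ <= X).
have -> : 64 * ((m%:R * w%:R * v%:R) * (n%:R * u%:R * y%:R)) =
  (4 * (w%:R * u%:R)) * (4 * (v%:R * y%:R)) * (4 * (m%:R * n%:R)) :> rat.
  by ring.
have le2 := ler_pM (nn w u) (nn v y) (amgm w u) (amgm v y).
exact: ler_pM (mulr_ge0 (nn w u) (nn v y)) (nn m n) le2 (amgm m n).
Qed.

(** The generators exceed 1, so 1 is a gap and the Frobenius number is a genuine
    one. *)
Lemma K1_g3_normal_form (d1 d2 d3 : nat) :
  (1 < d1)%N -> (1 < d2)%N -> (1 < d3)%N -> gcdn (gcdn d1 d2) d3 = 1%N ->
  exists C P Q al be ga : rat,
    [/\ [/\ 0 < C, 0 <= P & 0 <= Q], [/\ 0 <= al, 0 <= be & 0 <= ga],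
        [/\ al + be + ga = C - P - Q, al * be * ga = P * Q * C
          & 64 * (P * Q) <= C ^+ 2],
        12 * K1 d1 d2 d3 = K1_form C P Q al be ga &
        g3 d1 d2 d3 = C + Num.max P Q].
Proof.
move=> d1_gt1 d2_gt1 d3_gt1 gcd1.
have d1_gt0 := ltnW d1_gt1; have d2_gt0 := ltnW d2_gt1.
have d3_gt0 := ltnW d3_gt1.
have [u [v [w [y [m [n rel]]]]]] := relation_params_exist d1_gt0 d2_gt0 d3_gt0.
have gap1 : exists g, gaps (semigroup3 d1 d2 d3) g.
  exists 1%N; split=> // -[x [z [t]]].
  by case: x => [|x]; case: z => [|z]; case: t => [|t]; lia.
have frob := frobenius_lshape d1_gt0 d3_gt0 gcd1 rel gap1.
have K1_eq := K1_params d1_gt0 d3_gt0 gcd1 rel.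
have [def_d1 def_d2 def_d3] := rel.
exists ((w + u)%:R * (v + y)%:R * (m + n)%:R).
exists (m%:R * w%:R * v%:R), (n%:R * u%:R * y%:R).
exists (v%:R * n%:R * (w + u)%:R), (u%:R * m%:R * (v + y)%:R).
exists (w%:R * y%:R * (m + n)%:R); split.
- split; rewrite ?mulr_ge0 // -!natrM ltr0n.
  by move: d1_gt0 d3_gt0; rewrite def_d1 def_d3; nia.
- by split; rewrite !mulr_ge0.
- split; last exact: C_product.
    by rewrite !natrD; ring.
  by rewrite !natrD; ring.
- exact: K1_eq.
rewrite /g3 /sigma !expr1 -!natrD frob natrD !natrM.
by rewrite natr_max !natrM.
Qed.

Theorem mainTheorem3 (d1 d2 d3 : nat)
    (hgcd : gcdn (gcdn d1 d2) d3 = 1%N)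
    (hd1 : (3 <= d1)%N) (hd12 : (d1 < d2)%N) (hd23 : (d2 < d3)%N)
    (hd3 : (d3 <= d1 * d2 - d1 - d2)%N)
    (hmin1 : ~ lin_comb2 d2 d3 d1)
    (hmin2 : ~ lin_comb2 d1 d3 d2)
    (hmin3 : ~ lin_comb2 d1 d2 d3) :
  5 / 36 < h1 d1 d2 d3 /\ h1 d1 d2 d3 < 11 / 54.
Proof.
have d1_gt1 : (1 < d1)%N by lia.
have d2_gt1 : (1 < d2)%N by lia.
have d3_gt1 : (1 < d3)%N by lia.
have [C [P [Q [al [be [ga []]]]]]] :=
  K1_g3_normal_form d1_gt1 d2_gt1 d3_gt1 hgcd.
move=> [C0 P0 Q0] [al0 be0 ga0] [sum prod amgm] K1_eq g3_eq.
exact: (K1_form_bounds C0 P0 Q0 al0 be0 ga0 sum prod amgm K1_eq g3_eq).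
Qed.
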